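(* Let $A$ be an Artin algebra, $\{P_1,\dots,P_n\}$ a complete set of pairwise non-isomorphic projective indecomposable $A$-modules, $l_i$ the Loewy length of $P_i$, and $G=\bigoplus_{i=1}^n\bigoplus_{j=1}^{l_i}P_i/\operatorname{Rad}^jP_i$. Let $M$ be a rigid $A$-module of Loewy length $m$. Then the projective cover of $M$ in the category of $(A/\operatorname{Rad}^mA)$-modules is a right minimal $\operatorname{add}G$-approximation of $M$ (in the category of $A$-modules).
   Context: All modules are finitely generated left modules. A module is rigid if its radical series coincides with its socle series (so, if $M$ has Loewy length $m$, $\operatorname{Rad}^{m-j}M=\operatorname{Soc}_jM$ for $0\leq j\leq m$). $\operatorname{add}G$ is the full subcategory of modules isomorphic to a direct summand of a finite direct sum of copies of $G$. For a class $\mathcal{X}$ of $A$-modules, a morphism $f:X\to M$ with $X\in\mathcal{X}$ is a right $\mathcal{X}$-approximation of $M$ if $\operatorname{Hom}_A(X',f)$ is surjective for all $X'\in\mathcal{X}$. A morphism $f:X\to M$ is right minimal if every endomorphism $g$ of $X$ with $f=f\circ g$ is an automorphism; a right minimal $\mathcal{X}$-approximation is a right $\mathcal{X}$-approximation that is right minimal. A module of Loewy length $m$ is naturally an $(A/\operatorname{Rad}^mA)$-module, and $(A/\operatorname{Rad}^mA)$-modules are regarded as $A$-modules. *)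

(* Defs.v *)
From HB Require Import structures.
From mathcomp Require Import all_boot all_order all_algebra.
From mathcomp Require Import boolp.

Set Implicit Arguments.
Unset Strict Implicit.
Unset Printing Implicit Defensive.

Import GRing.Theory.
Local Open Scope ring_scope.
Local Open Scope quotient_scope.

(* Rings are [pzRingType]s, so the zero ring is allowed.  This matters for
   A / Rad^m A, which is the zero ring when m = 0.  A left A-module is an
   [lmodType A], and a submodule of V is a [submodClosed V]; the boolean
   membership tests are classical. *)

Section FinitelyGenerated.
Variables (A : pzRingType).

Definition finitely_generated (V : lmodType A) : Prop :=
  exists (k : nat) (s : 'I_k -> V),
    forall v : V, exists c : 'I_k -> A, v = \sum_(i < k) c i *: s i.

Definition isomorphic (U V : lmodType A) : Prop :=
  exists f : {linear U -> V}, bijective f.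

Definition surjective_map (U V : lmodType A) (f : U -> V) : Prop :=
  forall v, exists u, f u = v.

Definition zero_module (V : lmodType A) : Prop := forall v : V, v = 0.

Definition indecomposable (V : lmodType A) : Prop :=
  ~ zero_module V /\
  forall X Y : lmodType A,
    isomorphic (X * Y)%type V -> zero_module X \/ zero_module Y.

(* Projective objects of the category of finitely generated modules. *)
Definition projective (P : lmodType A) : Prop :=
  finitely_generated P /\
  forall (X Y : lmodType A) (g : {linear X -> Y}) (h : {linear P -> Y}),
    finitely_generated X -> finitely_generated Y -> surjective_map g ->
    exists k : {linear P -> X}, forall x, g (k x) = h x.

(* The last clause says that ker f is superfluous: N + ker f = P implies N = P. *)
Definition projective_cover (P M : lmodType A) (f : {linear P -> M}) : Prop :=
  [/\ projective P, surjective_map f &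
      forall N : submodClosed P,
        (forall x : P, exists2 y : P, y \in N & f (x - y) = 0) ->
        forall x : P, x \in N].

Definition complete_projective_indecomposables (n : nat)
    (P : 'I_n -> lmodType A) : Prop :=
  [/\ forall i, projective (P i) /\ indecomposable (P i),
      forall i j, isomorphic (P i) (P j) -> i = j &
      forall Q : lmodType A, projective Q -> indecomposable Q ->
        exists i, isomorphic Q (P i)].

End FinitelyGenerated.

Section Submodules.
Variables (A : pzRingType) (V : lmodType A).
Implicit Types N K L : submodClosed V.

Definition zero_submod_pred : {pred V} := [pred v | v == 0].

Lemma zero_submod_subproof : submod_closed zero_submod_pred.
Proof.
split=> [|a u v]; rewrite !inE // => /eqP-> /eqP->.
by rewrite scaler0 addr0.
Qed.

HB.instance Definition _ :=
  GRing.isSubmodClosed.Build A V zero_submod_pred zero_submod_subproof.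

Definition full_submod_pred : {pred V} := [pred v | true].

Lemma full_submod_subproof : submod_closed full_submod_pred.
Proof. by []. Qed.

HB.instance Definition _ :=
  GRing.isSubmodClosed.Build A V full_submod_pred full_submod_subproof.

Definition zero_submod : submodClosed V := zero_submod_pred.
Definition full_submod : submodClosed V := full_submod_pred.

Definition is_zero N : Prop := N =i zero_submod.

Definition maximal_in N K : Prop :=
  [/\ {subset K <= N}, ~ K =i N &
      forall L, {subset K <= L} -> {subset L <= N} -> L =i K \/ L =i N].

Definition simple_submod N : Prop :=
  ~ is_zero N /\ forall L, {subset L <= N} -> is_zero L \/ L =i N.

(* Rad N, for N regarded as a module in its own right. *)
Definition rad_pred N : {pred V} :=
  [pred v | `[< v \in N /\ forall K, maximal_in N K -> v \in K >]].

Lemma rad_predP N v :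
  reflect (v \in N /\ forall K, maximal_in N K -> v \in K) (v \in rad_pred N).
Proof. exact: asboolP. Qed.

Lemma rad_subproof N : submod_closed (rad_pred N).
Proof.
split=> [|a u v].
  by apply/rad_predP; split=> [|K _]; exact: rpred0.
move=> /rad_predP[Nu Ku] /rad_predP[Nv Kv]; apply/rad_predP.
split=> [|K maxK]; first by rewrite rpredD ?rpredZ.
by rewrite rpredD ?rpredZ ?(Ku _ maxK) ?(Kv _ maxK).
Qed.

HB.instance Definition _ N :=
  GRing.isSubmodClosed.Build A V (rad_pred N) (rad_subproof N).

Definition rad N : submodClosed V := rad_pred N.

Definition socle_pred : {pred V} :=
  [pred v | `[< exists (k : nat) (s : 'I_k -> V),
    (forall i, exists2 S : submodClosed V, simple_submod S & s i \in S) /\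
    v = \sum_(i < k) s i >]].

Lemma socle_predP v :
  reflect (exists (k : nat) (s : 'I_k -> V),
    (forall i, exists2 S : submodClosed V, simple_submod S & s i \in S) /\
    v = \sum_(i < k) s i) (v \in socle_pred).
Proof. exact: asboolP. Qed.

Lemma socle_subproof : submod_closed socle_pred.
Proof.
split=> [|a u v].
  apply/socle_predP; exists 0%N, (fun=> 0).
  by split=> [i|]; [case: i | rewrite big_ord0].
move=> /socle_predP[k [s [sS ->]]] /socle_predP[k' [s' [sS' ->]]].
apply/socle_predP.
exists (k + k')%N.
exists (fun i => match split i with inl j => a *: s j | inr j => s' j end).
split=> [i|].
  case: splitP => j _; last exact: sS'.
  by have [S simS Ssj] := sS j; exists S => //; rewrite rpredZ.
rewrite big_split_ord scaler_sumr; congr (_ + _); apply: eq_bigr => i _.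
  by rewrite (unsplitK (inl i)).
by rewrite (unsplitK (inr i)).
Qed.

HB.instance Definition _ :=
  GRing.isSubmodClosed.Build A V socle_pred socle_subproof.

Definition socle : submodClosed V := socle_pred.

Definition submod_zmod_pred N : {pred V} := [pred v | v \in N].

Lemma submod_zmod_subproof N : zmod_closed (submod_zmod_pred N).
Proof. by apply: GRing.submod_closedB; apply: submodClosedP. Qed.

HB.instance Definition _ N :=
  GRing.isZmodClosed.Build V (submod_zmod_pred N) (submod_zmod_subproof N).

(* [submodClosed V] does not coerce to [zmodClosed V]. *)
Definition submod_zmod N : zmodClosed V := submod_zmod_pred N.

End Submodules.

Arguments zero_submod {A V}.
Arguments full_submod {A V}.

Section QuotientModule.
Variables (A : pzRingType) (V : lmodType A) (N : submodClosed V).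

Definition quotmod : Type := Quotient.quot (submod_zmod N).

HB.instance Definition _ := GRing.Zmodule.on quotmod.

Definition quot_proj (v : V) : quotmod := \pi_(Quotient.quot (submod_zmod N)) v.
Definition quot_repr (x : quotmod) : V :=
  repr (x : Quotient.quot (submod_zmod N)).

Lemma quot_reprK : cancel quot_repr quot_proj.
Proof. exact: reprK. Qed.

Lemma quot_projD : {morph quot_proj : u v / u + v}.
Proof. by move=> u v; rewrite /quot_proj raddfD. Qed.

Lemma quot_projP u v : quot_proj u = quot_proj v <-> u - v \in N.
Proof.
rewrite -[u - v \in N]/(u - v \in submod_zmod N) Quotient.idealrBE.
by split=> [/eqP|/eqP].
Qed.

Definition quot_scale (a : A) (x : quotmod) : quotmod :=
  quot_proj (a *: quot_repr x).

Lemma quot_scaleE a v : quot_scale a (quot_proj v) = quot_proj (a *: v).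
Proof.
by apply/quot_projP; rewrite -scalerBr rpredZ //; apply/quot_projP/quot_reprK.
Qed.

Lemma quot_scaleA a b x : quot_scale a (quot_scale b x) = quot_scale (a * b) x.
Proof. by rewrite -[x]quot_reprK !quot_scaleE scalerA. Qed.

Lemma quot_scale1 : left_id 1 quot_scale.
Proof. by move=> x; rewrite -[x]quot_reprK quot_scaleE scale1r. Qed.

Lemma quot_scaleDr : right_distributive quot_scale +%R.
Proof.
move=> a x y; rewrite -[x]quot_reprK -[y]quot_reprK -quot_projD !quot_scaleE.
by rewrite scalerDr quot_projD.
Qed.

Lemma quot_scaleDl x : {morph quot_scale^~ x : a b / a + b}.
Proof.
by move=> a b; rewrite /= -[x]quot_reprK !quot_scaleE scalerDl quot_projD.
Qed.

HB.instance Definition _ :=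
  GRing.Zmodule_isLmodule.Build A quotmod
    quot_scaleA quot_scale1 quot_scaleDr quot_scaleDl.

Lemma quot_proj_is_linear : linear quot_proj.
Proof. by move=> a u v; rewrite quot_projD -quot_scaleE. Qed.

HB.instance Definition _ :=
  GRing.isLinear.Build A V quotmod *:%R quot_proj quot_proj_is_linear.

End QuotientModule.

Section Preimage.
Variables (A : pzRingType) (U V : lmodType A) (f : {linear U -> V}).
Variable N : submodClosed V.

Definition preimage_pred : {pred U} := [pred u | f u \in N].

Lemma preimage_subproof : submod_closed preimage_pred.
Proof.
split=> [|a u v]; rewrite !inE ?linear0 ?rpred0 // => Nu Nv.
by rewrite linearP rpredD ?rpredZ.
Qed.

HB.instance Definition _ :=
  GRing.isSubmodClosed.Build A U preimage_pred preimage_subproof.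

Definition preimage : submodClosed U := preimage_pred.

End Preimage.

Section Series.
Variables (A : pzRingType) (V : lmodType A).

Definition rad_series (j : nat) : submodClosed V := iter j (@rad A V) full_submod.

(* Soc_{i+1} V / Soc_i V = Soc (V / Soc_i V). *)
Fixpoint soc_series (j : nat) : submodClosed V :=
  if j is i.+1 then preimage (@quot_proj A V (soc_series i)) (socle _)
  else zero_submod.

Definition loewy_length (m : nat) : Prop :=
  is_zero (rad_series m) /\ forall k, is_zero (rad_series k) -> (m <= k)%N.

Definition rigid : Prop :=
  exists2 m, loewy_length m &
    forall j, (j <= m)%N -> rad_series (m - j) =i soc_series j.

End Series.

Definition restrict (A B : pzRingType) (phi : {rmorphism A -> B})
    (V : lmodType B) : Type := V.

Section Restriction.
Variables (A B : pzRingType) (phi : {rmorphism A -> B}) (V : lmodType B).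
Local Notation Vphi := (restrict phi V).

HB.instance Definition _ := GRing.Zmodule.on Vphi.

Definition restrict_scale (a : A) (v : Vphi) : Vphi :=
  (phi a *: (v : V) : V).

Lemma restrict_scaleA a b v :
  restrict_scale a (restrict_scale b v) = restrict_scale (a * b) v.
Proof. by rewrite /restrict_scale scalerA rmorphM. Qed.

Lemma restrict_scale1 : left_id 1 restrict_scale.
Proof. by move=> v; rewrite /restrict_scale rmorph1 scale1r. Qed.

Lemma restrict_scaleDr : right_distributive restrict_scale +%R.
Proof. by move=> a u v; rewrite /restrict_scale scalerDr. Qed.

Lemma restrict_scaleDl v : {morph restrict_scale^~ v : a b / a + b}.
Proof. by move=> a b; rewrite /restrict_scale rmorphD scalerDl. Qed.

HB.instance Definition _ :=
  GRing.Zmodule_isLmodule.Build A Vphi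
    restrict_scaleA restrict_scale1 restrict_scaleDr restrict_scaleDl.

End Restriction.

Section ArtinAlgebra.

Definition artinian (R : comPzRingType) : Prop :=
  forall I : nat -> submodClosed (R : pzRingType)^o,
    (forall k, {subset I k.+1 <= I k}) ->
    exists k, forall j, (k <= j)%N -> I j =i I k.

(* The structure map phi : R -> A is used instead of [algType R], because the
   latter excludes the zero algebra. *)
Definition artin_algebra (A : pzRingType) : Prop :=
  exists (R : comPzRingType) (phi : {rmorphism R -> A}),
    [/\ artinian R, forall r a, phi r * a = a * phi r &
        finitely_generated (restrict phi A^o)].

End ArtinAlgebra.

(* Linear maps preserve the radical series.  Applied to a |-> a *: v, this shows
   that Rad^m A is a two-sided ideal and that it annihilates every module of
   Loewy length m. *)
Section Functoriality.
Variables (A : pzRingType).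

Lemma maximal_preimage (U V : lmodType A) (f : {linear U -> V})
    (N : submodClosed U) (N' K : submodClosed V) :
  (forall u, u \in N -> f u \in N') -> maximal_in N' K ->
  forall u, u \in rad N -> f u \in K.
Proof.
move=> fN [sKN' neqK maxK] u /rad_predP[Nu radu].
have [//|/negP Kfu] := boolP (f u \in K).
pose N1 := [pred w : U | (w \in N) && (f w \in K)].
have N1c : submod_closed N1.
  split=> [|a w w']; first by rewrite inE linear0 !rpred0.
  rewrite !inE => /andP[Nw Kw] /andP[Nw' Kw'].
  by rewrite linearP !rpredD ?rpredZ.
pose K1 : submodClosed U := HB.pack (N1 : {pred U})
  (GRing.isSubmodClosed.Build A U N1 N1c).
have inK1 w : (w \in K1) = (w \in N) && (f w \in K) by [].
suff maxK1 : maximal_in N K1.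
  by have := radu K1 maxK1; rewrite inK1 => /andP[_ /Kfu].
split=> [w||L sKL sLN]; first by rewrite inK1 => /andP[].
  by move=> /(_ u); rewrite inK1 Nu => /Kfu.
have [sLK|/existsNP[w /not_implyP[Lw /negP K'w]]] := pselect {subset L <= K1}.
  by left=> w; apply/idP/idP; [exact: sLK | exact: sKL].
right=> w1; apply/idP/idP; first exact: sLN.
move=> Nw1.
pose N2 := [pred y : V | `[< exists2 z, z \in L & y - f z \in K >]].
have N2c : submod_closed N2.
  split=> [|a y y']; rewrite ?inE.
    by apply/asboolP; exists 0; rewrite ?rpred0 // linear0 subr0 rpred0.
  move=> /asboolP[z Lz Kz] /asboolP[z' Lz' Kz']; apply/asboolP.
  exists (a *: z + z'); first by rewrite rpredD ?rpredZ.
  by rewrite linearP opprD addrACA -scalerBr rpredD ?rpredZ.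
pose L2 : submodClosed V := HB.pack (N2 : {pred V})
  (GRing.isSubmodClosed.Build A V N2 N2c).
have inL2 y : (y \in L2) <-> exists2 z, z \in L & y - f z \in K.
  by rewrite -[y \in L2]/(`[< _ >]); split=> /asboolP.
have sKL2 : {subset K <= L2}.
  by move=> y Ky; apply/inL2; exists 0; rewrite ?rpred0 // linear0 subr0.
have sL2N : {subset L2 <= N'}.
  move=> y /inL2[z Lz Kz]; rewrite -(subrK (f z) y).
  by apply: rpredD; [exact: sKN' | apply: fN; exact: sLN].
case: (maxK L2 sKL2 sL2N) => eL2.
  have Kfw : f w \in K.
    by rewrite -eL2; apply/inL2; exists w; rewrite // subrr rpred0.
  by move: K'w; rewrite inK1 sLN // Kfw.
have /inL2[z Lz Kz] : f w1 \in L2 by rewrite eL2 fN.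
rewrite -(subrK z w1) rpredD // sKL // inK1 linearB Kz andbT.
by rewrite -scaleN1r rpredD ?rpredZ // sLN.
Qed.

Lemma rad_series_functor (U V : lmodType A) (f : {linear U -> V}) j u :
  u \in rad_series U j -> f u \in rad_series V j.
Proof.
elim: j u => [//|j IHj] u /= ru; apply/rad_predP; split.
  by apply: IHj; have /rad_predP[] := ru.
by move=> K maxK; apply: (maximal_preimage IHj maxK ru).
Qed.

End Functoriality.

Section RadicalQuotientRing.
Variables (A : pzRingType) (m : nat).

Definition rad_quot : Type := @quotmod A A^o (rad_series A^o m).

HB.instance Definition _ := GRing.Zmodule.on rad_quot.

Definition rad_proj (a : A) : rad_quot :=
  @quot_proj A A^o (rad_series A^o m) a.
Definition rad_repr (x : rad_quot) : A :=
  @quot_repr A A^o (rad_series A^o m) x.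

Lemma rad_reprK : cancel rad_repr rad_proj.
Proof. exact: quot_reprK. Qed.

Lemma rad_projP a b : rad_proj a = rad_proj b <-> a - b \in rad_series A^o m.
Proof. exact: quot_projP. Qed.

Lemma rad_projD : {morph rad_proj : a b / a + b}.
Proof. exact: (@quot_projD A A^o (rad_series A^o m)). Qed.

Definition act_on (V : lmodType A) (v : V) (a : A^o) : V := (a : A) *: v.

Lemma act_on_is_linear (V : lmodType A) (v : V) : linear (act_on v).
Proof. by move=> a b c; rewrite /act_on scalerDl scalerA. Qed.

HB.instance Definition _ (V : lmodType A) (v : V) :=
  GRing.isLinear.Build A A^o V *:%R (act_on v) (act_on_is_linear v).

Lemma rad_series_scale (V : lmodType A) (a : A) (v : V) :
  a \in rad_series A^o m -> a *: v \in rad_series V m.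
Proof. exact: (@rad_series_functor A A^o V (act_on v)). Qed.

Definition rad_mul (x y : rad_quot) : rad_quot :=
  rad_proj (rad_repr x * rad_repr y).

Lemma rad_mulE a b : rad_mul (rad_proj a) (rad_proj b) = rad_proj (a * b).
Proof.
apply/rad_projP; set a' := rad_repr _; set b' := rad_repr _.
have Ia : a' - a \in rad_series A^o m by apply/rad_projP/rad_reprK.
have Ib : b' - b \in rad_series A^o m by apply/rad_projP/rad_reprK.
have -> : a' * b' - a * b = (a' - a) * b' + a * (b' - b).
  by rewrite mulrBl mulrBr addrA subrK.
apply: (@rpredD A^o (rad_series A^o m)); last exact: (@rpredZ A A^o).
exact: (@rad_series_functor A A^o A^o (act_on (b' : A^o))).
Qed.

Lemma rad_mulA : associative rad_mul.
Proof.
move=> x y z; rewrite -[x]rad_reprK -[y]rad_reprK -[z]rad_reprK.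
by rewrite !rad_mulE mulrA.
Qed.

Lemma rad_mul1l : left_id (rad_proj 1) rad_mul.
Proof. by move=> x; rewrite -[x]rad_reprK rad_mulE mul1r. Qed.

Lemma rad_mul1r : right_id (rad_proj 1) rad_mul.
Proof. by move=> x; rewrite -[x]rad_reprK rad_mulE mulr1. Qed.

Lemma rad_mulDl : left_distributive rad_mul +%R.
Proof.
move=> x y z; rewrite -[x]rad_reprK -[y]rad_reprK -[z]rad_reprK.
by rewrite -rad_projD !rad_mulE mulrDl rad_projD.
Qed.

Lemma rad_mulDr : right_distributive rad_mul +%R.
Proof.
move=> x y z; rewrite -[x]rad_reprK -[y]rad_reprK -[z]rad_reprK.
by rewrite -rad_projD !rad_mulE mulrDr rad_projD.
Qed.

HB.instance Definition _ :=
  GRing.Zmodule_isPzRing.Build rad_quot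
    rad_mulA rad_mul1l rad_mul1r rad_mulDl rad_mulDr.

Lemma rad_proj_is_zmod_morphism : zmod_morphism rad_proj.
Proof. by move=> a b; rewrite /rad_proj raddfB. Qed.

Lemma rad_proj_is_monoid_morphism : monoid_morphism rad_proj.
Proof. by split=> // a b; rewrite -rad_mulE. Qed.

HB.instance Definition _ :=
  GRing.isZmodMorphism.Build A rad_quot rad_proj rad_proj_is_zmod_morphism.
HB.instance Definition _ :=
  GRing.isMonoidMorphism.Build A rad_quot rad_proj rad_proj_is_monoid_morphism.

End RadicalQuotientRing.

(* M of Loewy length m, regarded as an A / Rad^m A-module; conversely, [regard f]
   is f seen as an A-linear map through restriction of scalars. *)
Section Descent.
Variables (A : pzRingType) (M : lmodType A) (m : nat).
Variable hm : loewy_length M m.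

Definition descend of loewy_length M m : Type := M.
Local Notation Mbar := (descend hm).

HB.instance Definition _ := GRing.Zmodule.on Mbar.

Definition descend_scale (x : rad_quot A m) (v : Mbar) : Mbar :=
  (rad_repr x *: (v : M) : M).

Lemma descend_scaleE a v : descend_scale (rad_proj m a) v = a *: (v : M).
Proof.
apply/eqP; rewrite -subr_eq0 /descend_scale -scalerBl; apply/eqP.
set b := _ - a; have Ib : b \in rad_series A^o m by apply/rad_projP/rad_reprK.
by have /rad_series_scale-/(_ M v) := Ib; rewrite (hm.1) => /eqP.
Qed.

Lemma descend_scaleA x y v :
  descend_scale x (descend_scale y v) = descend_scale (x * y) v.
Proof.
rewrite -[x]rad_reprK -[y]rad_reprK -rmorphM !descend_scaleE.
by rewrite scalerA.
Qed.

Lemma descend_scale1 : left_id 1 descend_scale.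
Proof. by move=> v; rewrite -(rmorph1 (@rad_proj A m)) descend_scaleE scale1r. Qed.

Lemma descend_scaleDr : right_distributive descend_scale +%R.
Proof. by move=> x u v; rewrite /descend_scale scalerDr. Qed.

Lemma descend_scaleDl v : {morph descend_scale^~ v : x y / x + y}.
Proof.
move=> x y; rewrite /= -[x]rad_reprK -[y]rad_reprK -rmorphD !descend_scaleE.
by rewrite scalerDl.
Qed.

HB.instance Definition _ :=
  GRing.Zmodule_isLmodule.Build (rad_quot A m) Mbar
    descend_scaleA descend_scale1 descend_scaleDr descend_scaleDl.

Variables (Q : lmodType (rad_quot A m)) (f : {linear Q -> Mbar}).

Definition regard (x : restrict (@rad_proj A m) Q) : M := f x.

Lemma regard_is_linear : linear regard.
Proof.
move=> a u v; rewrite /regard -[a *: u]/(rad_proj m a *: (u : Q)) linearP.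
by rewrite -[rad_proj m a *: f u]/(descend_scale _ _) descend_scaleE.
Qed.

HB.instance Definition _ :=
  GRing.isLinear.Build A (restrict (@rad_proj A m) Q) M *:%R
    regard regard_is_linear.

End Descent.

Section DirectSum.
Variables (A : pzRingType) (I : finType) (V : I -> lmodType A).

Definition dsum : Type := {dffun forall i : I, V i}.

HB.instance Definition _ := Choice.on dsum.

Definition dsum_zero : dsum := [ffun i => 0 : V i].
Definition dsum_opp (x : dsum) : dsum := [ffun i => - x i : V i].
Definition dsum_add (x y : dsum) : dsum := [ffun i => x i + y i : V i].
Definition dsum_scale (a : A) (x : dsum) : dsum := [ffun i => a *: x i : V i].

Lemma dsum_addA : associative dsum_add.
Proof. by move=> x y z; apply/ffunP=> i; rewrite !ffunE addrA. Qed.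

Lemma dsum_addC : commutative dsum_add.
Proof. by move=> x y; apply/ffunP=> i; rewrite !ffunE addrC. Qed.

Lemma dsum_add0 : left_id dsum_zero dsum_add.
Proof. by move=> x; apply/ffunP=> i; rewrite !ffunE add0r. Qed.

Lemma dsum_addN : left_inverse dsum_zero dsum_opp dsum_add.
Proof. by move=> x; apply/ffunP=> i; rewrite !ffunE addNr. Qed.

HB.instance Definition _ :=
  GRing.isZmodule.Build dsum dsum_addA dsum_addC dsum_add0 dsum_addN.

Lemma dsum_scaleA a b x : dsum_scale a (dsum_scale b x) = dsum_scale (a * b) x.
Proof. by apply/ffunP=> i; rewrite !ffunE scalerA. Qed.

Lemma dsum_scale1 : left_id 1 dsum_scale.
Proof. by move=> x; apply/ffunP=> i; rewrite !ffunE scale1r. Qed.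

Lemma dsum_scaleDr : right_distributive dsum_scale +%R.
Proof. by move=> a x y; apply/ffunP=> i; rewrite !ffunE scalerDr. Qed.

Lemma dsum_scaleDl x : {morph dsum_scale^~ x : a b / a + b}.
Proof. by move=> a b; apply/ffunP=> i; rewrite !ffunE scalerDl. Qed.

HB.instance Definition _ :=
  GRing.Zmodule_isLmodule.Build A dsum
    dsum_scaleA dsum_scale1 dsum_scaleDr dsum_scaleDl.

End DirectSum.

Section Approximations.
Variables (A : pzRingType).

Definition add_closure (G X : lmodType A) : Prop :=
  exists (k : nat) (Y : lmodType A), isomorphic (X * Y)%type {ffun 'I_k -> G}.

Definition right_approximation (C : lmodType A -> Prop) (X M : lmodType A)
    (f : {linear X -> M}) : Prop :=
  C X /\
  forall (X' : lmodType A) (h : {linear X' -> M}), C X' ->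
    exists g : {linear X' -> X}, forall x, f (g x) = h x.

Definition right_minimal (X M : lmodType A) (f : {linear X -> M}) : Prop :=
  forall g : {linear X -> X}, (forall x, f (g x) = f x) -> bijective g.

Definition right_minimal_approximation (C : lmodType A -> Prop)
    (X M : lmodType A) (f : {linear X -> M}) : Prop :=
  right_approximation C f /\ right_minimal f.

(* The summand P i / Rad^j (P i) with 1 <= j <= l i has index j - 1 : 'I_(l i). *)
Definition rad_quotients_sum (n : nat) (P : 'I_n -> lmodType A)
    (l : 'I_n -> nat) : lmodType A :=
  dsum (fun i : 'I_n =>
    dsum (fun j : 'I_(l i) =>
      quotmod (rad_series (P i) j.+1) : lmodType A) : lmodType A).

End Approximations.

(* Main.v *)
(* With J = Rad A, the algebra A / J is semisimple, so Rad^k V = J^k V for every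
   module V, and Soc_k V contains all elements killed by J^k.  A morphism from
   P_i / Rad^j P_i to M thus has image in Soc_j M, which is Rad^(m-j) M by
   rigidity; Rad^(m-j) Q maps onto it, so the morphism lifts to a map from P_i
   to Rad^(m-j) Q, and this lift kills Rad^j P_i because Rad^m Q = 0.
   Moreover Q is a direct summand of a free (A / Rad^m A)-module, and A is a
   direct sum of copies of the P_i, so A / Rad^m A is a direct sum of copies of
   the P_i / Rad^m P_i.  Finally, an endomorphism of Q compatible with the cover
   is onto by superfluity of the kernel and splits by projectivity; the section
   is again compatible with the cover, hence onto. *)

Require Import Defs.
From HB Require Import structures.
From mathcomp Require Import all_boot all_order all_algebra.
From mathcomp Require Import boolp classical_sets.

Set Implicit Arguments.
Unset Strict Implicit.
Unset Printing Implicit Defensive.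

Import GRing.Theory.
Local Open Scope ring_scope.

(** * Submodules and descending chains *)

Section Packing.
Variables (A : pzRingType).

(** Existence form: a linear map can then be built from a formula inside a proof, with no instance
    declared. *)
Lemma linear_ex (U V : lmodType A) (f : U -> V) :
  linear f -> exists g : {linear U -> V}, forall x, g x = f x.
Proof.
move=> lf; pose g : {linear U -> V} := HB.pack f (GRing.isLinear.Build A U V *:%R f lf).
by exists g.
Qed.

Lemma submod_ex (V : lmodType A) (S : V -> Prop) :
  S 0 -> (forall a u v, S u -> S v -> S (a *: u + v)) ->
  exists N : submodClosed V, forall v, v \in N <-> S v.
Proof.
move=> S0 SP; pose p := [pred v : V | `[< S v >]].
have pc : submod_closed p.
  split=> [|a u v]; first exact/asboolP.
  by move=> /asboolP Su /asboolP Sv; apply/asboolP/SP.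
pose N : submodClosed V := HB.pack (p : {pred V}) (GRing.isSubmodClosed.Build A V p pc).
by exists N => v; split=> /asboolP.
Qed.

Lemma submod_scaleD (V : lmodType A) (N : submodClosed V) a u v :
  u \in N -> v \in N -> a *: u + v \in N.
Proof. by move=> Nu Nv; rewrite rpredD ?rpredZ. Qed.

Lemma submodB (V : lmodType A) (N : submodClosed V) u v :
  u \in N -> v \in N -> u - v \in N.
Proof. by move=> Nu Nv; rewrite addrC -scaleN1r; apply: submod_scaleD. Qed.

Lemma image_submod_ex (U V : lmodType A) (f : {linear U -> V}) (N : submodClosed U) :
  exists K : submodClosed V, forall v, v \in K <-> exists2 u, u \in N & f u = v.
Proof.
apply: submod_ex => [|a u v [x Nx <-] [y Ny <-]].
  by exists 0; rewrite ?rpred0 ?linear0.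
by exists (a *: x + y); [exact: submod_scaleD | rewrite linearP].
Qed.

Lemma cap_submod_ex (V : lmodType A) (N K : submodClosed V) :
  exists L : submodClosed V, forall v, v \in L <-> v \in N /\ v \in K.
Proof.
apply: submod_ex => [|a u v [Nu Ku] [Nv Kv]]; first by rewrite !rpred0.
by split; apply: submod_scaleD.
Qed.

Lemma add_submod_ex (V : lmodType A) (N K : submodClosed V) :
  exists L : submodClosed V,
    forall v, v \in L <-> exists x y, [/\ x \in N, y \in K & v = x + y].
Proof.
apply: submod_ex => [|a u v [x [y [Nx Ky ->]]] [x' [y' [Nx' Ky' ->]]]].
  by exists 0, 0; rewrite !rpred0 addr0.
exists (a *: x + x'), (a *: y + y'); split; try exact: submod_scaleD.
by rewrite scalerDr addrACA.
Qed.

Lemma line_submod_ex (V : lmodType A) (s : V) :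
  exists K : submodClosed V, forall v, v \in K <-> exists a, v = a *: s.
Proof.
apply: submod_ex => [|a u v [x ->] [y ->]]; first by exists 0; rewrite scale0r.
by exists (a * x + y); rewrite scalerDl scalerA.
Qed.

End Packing.

(** * Minimality principle for left ideals of an Artin algebra *)

Section DescendingChains.

Definition dcc_below (R : pzRingType) (V : lmodType R) (N : submodClosed V) :=
  forall I : nat -> submodClosed V,
    (forall k, {subset I k <= N}) -> (forall k, {subset I k.+1 <= I k}) ->
    exists k, forall j, (k <= j)%N -> {subset I k <= I j}.

Lemma chain_subset (R : pzRingType) (V : lmodType R) (I : nat -> submodClosed V) :
  (forall k, {subset I k.+1 <= I k}) ->
  forall i j, (i <= j)%N -> {subset I j <= I i}.
Proof.
move=> dI i j /subnKC <-; elim: (j - i)%N => [|d IHd] v; first by rewrite addn0.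
by rewrite addnS => /dI /IHd.
Qed.

(** Adjoining one generator [s] to [N] keeps the chain condition: a chain in [K] is controlled by
    its coefficients at [s], which form ideals of [R], together with its traces on [N]. *)
Lemma dcc_line_add (R : comPzRingType) (V : lmodType R) (N K : submodClosed V) s :
  artinian R -> dcc_below N ->
  (forall v, v \in K -> exists (r : R) (x : V), x \in N /\ v = r *: s + x) ->
  dcc_below K.
Proof.
move=> artR dccN genK I IK dI.
have exC k : exists C : submodClosed (R : pzRingType)^o,
    forall r, r \in C <-> exists2 x, x \in N & (r : R) *: s + x \in I k.
  apply: submod_ex => [|a r r' [x Nx Ix] [x' Nx' Ix']].
    by exists 0; rewrite ?rpred0 // scale0r addr0 rpred0.
  exists (a *: x + x'); first exact: submod_scaleD.
  rewrite scalerDl -[(a *: r : R^o)]/(a * r) -scalerA addrACA -scalerDr.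
  exact: submod_scaleD.
have exD k : exists D : submodClosed V, forall x, x \in D <-> x \in I k /\ x \in N.
  exact: cap_submod_ex.
have [C CE] := choice exC; have [D DE] := choice exD.
have [|k1 k1P] := artR C.
  by move=> k r /CE[x Nx Ix]; apply/CE; exists x => //; apply: dI.
have [||k2 k2P] := dccN D.
- by move=> k x /DE[].
- by move=> k x /DE[Ix Nx]; apply/DE; split=> //; apply: dI.
exists (maxn k1 k2) => j; rewrite geq_max => /andP[k1j k2j] v Iv.
have [r [x [Nx Ev]]] := genK v (IK _ _ Iv).
have : r \in C j.
  rewrite (k1P _ k1j); apply/CE; exists x => //; rewrite -Ev.
  by apply: chain_subset Iv => //; rewrite leq_maxl.
move=> /CE[y Ny Iy].
(* Both terms have coefficient [r] at [s], so their difference falls into [N]. *)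
have : v - (r *: s + y) \in D j.
  apply: (k2P _ k2j); apply/DE; split.
    apply: submodB; first by apply: chain_subset Iv => //; rewrite leq_maxr.
    by apply: chain_subset Iy.
  by rewrite Ev opprD addrACA subrr add0r submodB.
by move=> /DE[Iz _]; rewrite -(subrK (r *: s + y) v) rpredD.
Qed.

Lemma dcc_finitely_generated (R : comPzRingType) (V : lmodType R) :
  artinian R -> finitely_generated V -> dcc_below (@full_submod R V).
Proof.
move=> artR [k [s gen]].
(* The span of the generators of index below [i]; it grows by one generator at each step and is
   constant from [k] on. *)
pose span i v := exists c : 'I_k -> R, v = \sum_(t < k | (t < i)%N) c t *: s t.
have exN i : exists N : submodClosed V, forall v, v \in N <-> span i v.
  apply: submod_ex => [|a u v [c ->] [c' ->]].
    by exists (fun=> 0); rewrite big1 // => t _; rewrite scale0r.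
  exists (fun t => a * c t + c' t).
  rewrite scaler_sumr -big_split; apply: eq_bigr => t _.
  by rewrite /= scalerDl scalerA.
have [N NE] := choice exN.
have dccN i : dcc_below (N i).
  elim: i => [|i IHi].
    move=> I IN dI; exists 0%N => j _ v /IN /NE[c ->].
    by rewrite big_pred0 ?rpred0 // => t.
  have [ik|ki] := ltnP i k.
    apply: (@dcc_line_add _ _ (N i) _ (s (Ordinal ik))) => // v /NE[c ->].
    exists (c (Ordinal ik)), (\sum_(t < k | (t < i)%N) c t *: s t).
    split; first by apply/NE; exists c.
    rewrite (bigD1 (Ordinal ik)) ?ltnSn //=; congr (_ + _).
    by apply: eq_bigl => t; rewrite ltnS [RHS]ltn_neqAle andbC.
  move=> I IN; apply: IHi => j v /IN /NE[c ->]; apply/NE; exists c.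
  by apply: eq_bigl => t; rewrite ltnS leq_eqVlt (leq_trans (ltn_ord t) ki) orbT.
move=> I _; apply: (dccN k) => j v _; have [c ->] := gen v; apply/NE; exists c.
by apply: eq_bigl => t; rewrite ltn_ord.
Qed.

(** Without a minimal member, dependent choice yields a strictly descending chain of left ideals.
    Over [R] these are submodules of a finitely generated module, so the chain must stop. *)
Lemma artin_minimal (A : pzRingType) (C : submodClosed A^o -> Prop) :
  artin_algebra A -> (exists N, C N) ->
  exists2 N, C N & forall K, C K -> {subset K <= N} -> {subset N <= K}.
Proof.
move=> [R [phi [artR comm fgA]]] [N0 CN0]; apply: contrapT => noMin.
have step (N : {N | C N}) :
    {K : {N | C N} | {subset sval K <= sval N} /\ ~ {subset sval N <= sval K}}.
  apply: cid; case: N => N CN /=; apply: contrapT => noK; apply: noMin.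
  exists N => // K CK sKN; apply: contrapT => nNK; apply: noK.
  by exists (exist _ K CK).
have [I [_ IP]] := dependent_choice step (exist _ N0 CN0).
have exI k : exists L : submodClosed (restrict phi A^o),
    forall v : A^o, v \in L <-> v \in sval (I k).
  apply: submod_ex => [|a u v Iu Iv]; first exact: rpred0.
  exact: submod_scaleD.
have [L LE] := choice exI.
have [||k kP] := dcc_finitely_generated artR fgA (I := L).
- by [].
- by move=> k v /LE v1; apply/LE; apply: (IP k).1.
case: (IP k) => _; apply=> v /LE Lv; apply/LE.
by apply: kP Lv.
Qed.

End DescendingChains.

(** * Radical and socle series over an Artin algebra *)

Section RadicalSeries.
Variables (A : pzRingType).
Implicit Type V : lmodType A.

Lemma rad_series_subset V i j :
  (i <= j)%N -> {subset rad_series V j <= rad_series V i}.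
Proof. by apply: chain_subset => k v /rad_predP[]. Qed.

(** The map [a |-> a *: v] sends [A] into the [j]-th radical, and each further radical step on the
    left forces one on the right. *)
Lemma rad_series_act V i j (a : A) (v : V) :
  a \in rad_series A^o i -> v \in rad_series V j -> a *: v \in rad_series V (i + j).
Proof.
move=> + rv; elim: i a => [|i IHi] a ra; first exact: rpredZ.
apply/rad_predP; split; first by apply: IHi; have /rad_predP[] := ra.
by move=> K maxK; apply: (maximal_preimage (f := act_on v) IHi maxK ra).
Qed.

Lemma rad_act V (N : submodClosed V) (a : A) (v : V) :
  a \in rad_series A^o 1 -> v \in N -> a *: v \in Defs.rad N.
Proof.
move=> ra Nv; apply/rad_predP; split=> [|K maxK]; first exact: rpredZ.
by apply: (maximal_preimage (f := act_on v) _ maxK ra) => b _; apply: rpredZ.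
Qed.

Lemma rad_series_mulr k (a b : A) :
  a \in rad_series A^o k -> a * b \in rad_series A^o k.
Proof. exact: (@rad_series_functor A A^o A^o (act_on (b : A^o))). Qed.

End RadicalSeries.

(** * Semisimplicity modulo the radical and its effect on both series *)

Section Semisimplicity.
Variable (A : pzRingType).

(* 1 is, modulo L, a sum of elements generating submodules of A / L that are
   zero or simple. *)
Definition semisimple_mod (L : submodClosed A^o) :=
  exists (k : nat) (c : 'I_k -> A),
    1 - \sum_(i < k) c i \in L /\
    forall i b, b * c i \in L \/ exists d, d * (b * c i) - c i \in L.

Lemma semisimple_mod_full : semisimple_mod (@full_submod A A^o).
Proof. by exists 0%N, (fun=> 0); split=> // -[]. Qed.

(** Since [L + K = A], the quotient by [L'] is the direct sum of [A / L] and the simple module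
    [A / K]. *)
Lemma semisimple_mod_cap (L K L' : submodClosed A^o) :
  semisimple_mod L -> maximal_in (@full_submod A A^o) K -> ~ {subset L <= K} ->
  (forall a, a \in L' <-> a \in L /\ a \in K) -> semisimple_mod L'.
Proof.
move=> [k [c [c1 cS]]] [_ _ maxK] /existsNP[x /not_implyP[Lx /negP Kx]] L'E.
have gen y : y \notin K -> exists (d : A) (t : A), t \in K /\ 1 = d * y + t.
  move=> Ky; have [H HE] := line_submod_ex (y : A^o).
  have [S SE] := add_submod_ex H K.
  have [||SK|Sfull] := maxK S.
  - by move=> v Kv; apply/SE; exists 0, v; rewrite rpred0 add0r.
  - by [].
  - case/negP: Ky; rewrite -SK; apply/SE; exists y, 0; rewrite rpred0 addr0.
    by split=> //; apply/HE; exists 1; rewrite scale1r.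
  - have /SE[_ [t [/HE[d ->] Kt E]]] : (1 : A^o) \in S by rewrite Sfull.
    by exists d, t.
(* [1 = e + t] with [e] in [L] and [t] in [K]; right multiplication by [t] sends [L] into the
   intersection. *)
have [d [t [Kt E1]]] := gen x Kx; pose e := d * x.
have Le : e \in L by exact: (@rpredZ A A^o).
have LMe a : a * e \in L by exact: (@rpredZ A A^o).
have KMt a : a * t \in K by exact: (@rpredZ A A^o).
have tE : t = 1 - e by rewrite E1 addrC addKr.
have LMt a : a \in L -> a * t \in L.
  by move=> La; rewrite tE mulrBr mulr1 (@submodB A A^o).
(* The old elements are pushed into [K] by [t], and [e] generates the new simple summand. *)
pose c' i := if unlift ord0 i is Some j then c j * t else e.
exists k.+1, c'; split.
  have -> : 1 - \sum_(i < k.+1) c' i = (1 - \sum_(i < k) c i) * t.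
    rewrite big_ord_recl {1}/c' unlift_none opprD addrA -tE mulrBl mul1r.
    rewrite mulr_suml; congr (_ - _); apply: eq_bigr => i _.
    by rewrite /c' liftK.
  by apply/L'E; split=> //; apply: LMt.
move=> i b; rewrite /c'; case: unliftP => [j _|_].
  rewrite mulrA; case: (cS j b) => [Lb|[d' Ld']]; [left|right; exists d'].
    by apply/L'E; split=> //; apply: LMt.
  rewrite mulrA -mulrBl; apply/L'E; split=> //.
  exact: LMt.
have [Kbe|Kbe] := boolP (b * e \in K); [by left; apply/L'E | right].
have [d' [t' [Kt' E']]] := gen _ Kbe.
(* The leading [e] leaves [- e * t'] modulo nothing, which is in [K]; both terms of the difference
   are multiples of [e], hence in [L]. *)
exists (e * d'); apply/L'E; split; first by apply: (@submodB A A^o); rewrite // mulrA.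
rewrite -mulrA -[X in _ - X]mulr1 -mulrBr.
have -> : d' * (b * e) - 1 = - t' by rewrite E' opprD addrA subrr add0r.
by rewrite mulrN -mulNr; exact: (@rpredZ A A^o).
Qed.

Hypothesis hA : artin_algebra A.

(** A minimal [L] with semisimple quotient lies in every maximal left ideal, as intersecting with
    one that misses part of it would shrink it. Thus [L] is inside the radical, and the
    decomposition survives modulo the radical. *)
Lemma artin_semisimple_mod_rad : semisimple_mod (rad_series A^o 1).
Proof.
have [|L ssL minL] := artin_minimal (C := semisimple_mod) hA.
  by exists full_submod; apply: semisimple_mod_full.
have sLJ : {subset L <= rad_series A^o 1}.
  move=> a La; apply/rad_predP; split=> // K maxK; apply: contrapT => Ka.
  have nsLK : ~ {subset L <= K} by move=> /(_ a La).
  have [L' L'E] := cap_submod_ex L K; apply: nsLK => b Lb.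
  have /L'E[//] : b \in L'; apply: minL Lb.
    by apply: semisimple_mod_cap L'E => // /(_ a La).
  by move=> x /L'E[].
have [k [c [c1 cS]]] := ssL; exists k, c; split; first exact: sLJ.
by move=> i b; case: (cS i b) => [/sLJ|[d /sLJ]]; [left | right; exists d].
Qed.

Lemma socle_kill (V : lmodType A) (v : V) :
  (forall a : A, a \in rad_series A^o 1 -> a *: v = 0) -> v \in socle V.
Proof.
have [k [c [c1 cS]]] := artin_semisimple_mod_rad; move=> Jv.
have -> : v = \sum_(i < k) c i *: v.
  by rewrite -scaler_suml; apply/eqP; rewrite -subr_eq0 -{1}[v]scale1r -scalerBl Jv.
apply: rpred_sum => i _; have [->|s0] := eqVneq (c i *: v) 0; first exact: rpred0.
apply/socle_predP; exists 1%N, (fun=> c i *: v); rewrite big_ord1; split=> // _.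
have [S SE] := line_submod_ex (c i *: v).
have Ss : c i *: v \in S by apply/SE; exists 1; rewrite scale1r.
exists S => //; split=> [S0|L sLS].
  by have := S0 (c i *: v); rewrite Ss => /esym /eqP; apply/eqP.
have [L0|/existsNP[x /not_implyP[Lx /eqP x0]]] := pselect (forall x, x \in L -> x = 0).
  left=> x; apply/idP/idP => [/L0->|/eqP->]; exact: rpred0.
right=> y; apply/idP/idP; first exact: sLS.
(* A nonzero multiple [b c_i v] can be multiplied back to [c_i v], so any nonzero [L] is the whole
   line. *)
have /SE[b xE] := sLS _ Lx; move=> /SE[b' ->]; apply: rpredZ.
case: (cS i b) => [/Jv|[d /Jv]].
  by rewrite -scalerA -xE => /eqP; rewrite (negPf x0).
move=> /eqP; rewrite scalerBl subr_eq0 => /eqP<-.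
by rewrite -!scalerA -xE rpredZ.
Qed.

(* By Zorn, take [L] maximal among the submodules of [N] containing [K] but not
   [v]; every submodule of [N] strictly above [L] contains [v], and N / L is
   semisimple, so [L] is maximal in [N]. *)
Lemma rad_minimal (V : lmodType A) (N K : submodClosed V) (v : V) :
  (forall (a : A) w, a \in rad_series A^o 1 -> w \in N -> a *: w \in K) ->
  v \in Defs.rad N -> v \in K.
Proof.
move=> JNK /rad_predP[Nv radv]; apply: contrapT => Kv.
(* [K] need not lie in [N], so Zorn starts from [K] cut down to [N]. *)
have [K1 K1E] := cap_submod_ex K N.
pose T := {L : submodClosed V |
  [/\ {subset K1 <= L}, {subset L <= N} & v \notin L]}.
pose rel (L L' : T) := `[< {subset sval L <= sval L'} >].
have T0 : T.
  by exists K1; split=> // [x /K1E[]//|]; apply/negP => /K1E[].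
have [|L1 L2 L3 /asboolP s12 /asboolP s23||[L [sKL sLN Lv]] Lmax] :=
    @ZL_preorder T T0 rel.
- by move=> L; apply/asboolP.
- by apply/asboolP => x /s12/s23.
- move=> C totC; have [C0|/existsNP[L0 /contrapT CL0]] := pselect (forall L, ~ C L).
    by exists T0 => L /C0.
  have [|a x y [L [CL Lx]] [L' [CL' Ly]]|U UE] :=
      @submod_ex A V (fun x => exists L, C L /\ x \in sval L).
  + by exists L0; rewrite rpred0.
  + case: (totC _ _ CL CL') => /asboolP sLL.
      by exists L'; split=> //; apply: submod_scaleD => //; apply: sLL.
    by exists L; split=> //; apply: submod_scaleD => //; apply: sLL.
  have UP : [/\ {subset K1 <= U}, {subset U <= N} & v \notin U].
    case: (svalP L0) => s0 _ _; split=> [x /s0 Lx|x /UE[L [_ Lx]]|].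
    + by apply/UE; exists L0.
    + by case: (svalP L) => _ + _; apply.
    + by apply/negP => /UE[L [_]]; apply/negP; case: (svalP L).
  by exists (exist _ U UP) => L CL; apply/asboolP => x Lx; apply/UE; exists L.
have {}Lmax (L' : submodClosed V) : {subset L <= L'} -> {subset L' <= N} ->
    v \in L' \/ {subset L' <= L}.
  move=> sLL' sL'N; have [|L'v] := boolP (v \in L'); [by left | right].
  have PL' : [/\ {subset K1 <= L'}, {subset L' <= N} & v \notin L'].
    by split=> // x /sKL /sLL'.
  by have /asboolP := Lmax (exist _ L' PL') (introT (asboolP _) sLL').
have maxL : maximal_in N L.
  split=> // [LN|L' sLL' sL'N]; first by case/negP: Lv; rewrite LN.
  case: (Lmax L' sLL' sL'N) => [L'v|sL'L]; [right|left] => w; apply/idP/idP.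
  - exact: sL'N.
  - move=> Nw.
    have JwL (a : A) : a \in rad_series A^o 1 -> a *: w \in L.
      by move=> Ja; apply/sKL/K1E; split; [exact: JNK | exact: rpredZ].
    have [k [c [c1 cS]]] := artin_semisimple_mod_rad.
    have -> : w = \sum_(i < k) c i *: w + (1 - \sum_(i < k) c i) *: w.
      by rewrite -scaler_suml -scalerDl addrC subrK scale1r.
    apply: rpredD; last exact/sLL'/JwL.
    apply: rpred_sum => i _.
    (* Either [L + A c_i w] contains [v], and then [c_i w] is recovered from [v] modulo [L], or it
       lies in [L]. *)
    have [H HE] := line_submod_ex (c i *: w); have [S SE] := add_submod_ex L H.
    have [||/SE[x [_ [Lx /HE[b ->] vE]]]|sSL] := Lmax S.
    + by move=> x Lx; apply/SE; exists x, 0; rewrite rpred0 addr0.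
    + move=> _ /SE[x [_ [Lx /HE[b ->] ->]]].
      by rewrite rpredD ?rpredZ // sLN.
    + case: (cS i b) => [/JwL|[d /JwL Ld]].
        by rewrite -scalerA => Lb; case/negP: Lv; rewrite vE rpredD.
      have -> : c i *: w = d *: (v - x) - (d * (b * c i) - c i) *: w.
        by rewrite vE [x + _]addrC addrK scalerBl -!scalerA opprB addrCA subrr addr0.
      apply: submodB; last exact: sLL'.
      by rewrite rpredZ // submodB // sLL'.
    + apply/sLL'/sSL/SE; exists 0, (c i *: w); rewrite rpred0 add0r; split=> //.
      by apply/HE; exists 1; rewrite scale1r.
  - exact: sL'L.
  - exact: sLL'.
by case/negP: Lv; exact: radv.
Qed.

(** The induction replaces [K] by the submodule of all [w] whose multiples by the radical of [A] lie
    in [K]. *)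
Lemma rad_series_minimal (V : lmodType A) k (K : submodClosed V) (v : V) :
  (forall (a : A) w, a \in rad_series A^o k -> a *: w \in K) ->
  v \in rad_series V k -> v \in K.
Proof.
elim: k K v => [|k IHk] K v JK; first by move=> _; rewrite -[v]scale1r JK.
apply: rad_minimal => a w Ja rw.
have [|b x y Sx Sy c Jc|S SE] := @submod_ex A V
    (fun w => forall c : A, c \in rad_series A^o 1 -> c *: w \in K).
- by move=> c _; rewrite scaler0 rpred0.
- rewrite scalerDr scalerA rpredD ?Sy // Sx //.
  exact: rad_series_mulr.
suff /SE/(_ a Ja) : w \in S by [].
apply: IHk rw => b x rb; apply/SE => c Jc.
by rewrite scalerA JK //; apply: (rad_series_act (V := A^o)) Jc rb.
Qed.

(** The image of the next radical of [U] contains all radical multiples of the current radical of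
    [V], so [rad_minimal] applies. *)
Lemma rad_series_lift (U V : lmodType A) (f : {linear U -> V}) k v :
  surjective_map f -> v \in rad_series V k ->
  exists2 u, u \in rad_series U k & f u = v.
Proof.
move=> sf; elim: k v => [v _|k IHk v rv].
  by have [u <-] := sf v; exists u.
have [K KE] := image_submod_ex f (rad_series U k.+1).
apply/KE; apply: rad_minimal rv => a w Ja /IHk[u ru <-].
by apply/KE; exists (a *: u); [exact: rad_act | rewrite linearZ].
Qed.

(** With [J] the radical of [A], this is [J^k v = 0], taken one factor at a time to follow the
    recursion of [soc_series]. *)
Fixpoint rad_killed (V : lmodType A) k (v : V) : Prop :=
  if k is j.+1 then forall a : A, a \in rad_series A^o 1 -> rad_killed j (a *: v)
  else v = 0.

Lemma soc_series_killed (V : lmodType A) k (v : V) :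
  rad_killed k v -> v \in soc_series V k.
Proof.
elim: k v => [v ->|k IHk v kv]; first exact: rpred0.
suff: quot_proj (soc_series V k) v \in socle _ by [].
apply: socle_kill => a Ja.
rewrite -linearZ -(linear0 (@quot_proj A V (soc_series V k))).
by apply/quot_projP; rewrite subr0; apply/IHk/kv.
Qed.

Lemma rad_killed_image (U V : lmodType A) (f : {linear U -> V}) i j (u : U) :
  (forall x, x \in rad_series U (i + j) -> f x = 0) ->
  u \in rad_series U i -> rad_killed j (f u).
Proof.
elim: j i u => [|j IHj] i u f0 ru; first by apply: f0; rewrite addn0.
move=> a Ja; rewrite -linearZ; apply: (IHj i.+1); last exact: rad_act.
by move=> x; rewrite addSnnS; apply: f0.
Qed.

End Semisimplicity.

(** * Summands of finite direct sums *)

Section Factorizations.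
Variable A : pzRingType.
Implicit Types U V W X Y : lmodType A.

(* [f] is a finite sum of composites of linear maps through members of the
   family [V]; when [f] is the identity of [X], this says that [X] is a direct
   summand of a finite direct sum of such members. *)
Inductive factors (I : Type) (V : I -> lmodType A) X Y : (X -> Y) -> Prop :=
| Factors0 (f : X -> Y) : (forall x, f x = 0) -> factors V f
| FactorsD (f g : X -> Y) i (a : {linear X -> V i}) (b : {linear V i -> Y}) :
    factors V g -> (forall x, f x = b (a x) + g x) -> factors V f.

Lemma eq_factors I (V : I -> lmodType A) X Y (f g : X -> Y) :
  f =1 g -> factors V f -> factors V g.
Proof.
move=> fg Vf; case: Vf fg => [f' f0|f' g' i a b Vg' fE] fg.
  by apply: Factors0 => x; rewrite -fg.
by apply: (FactorsD (a := a) (b := b) Vg') => x; rewrite -fg.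
Qed.

Lemma factors_single I (V : I -> lmodType A) X Y i
    (a : {linear X -> V i}) (b : {linear V i -> Y}) :
  factors V (fun x => b (a x)).
Proof.
apply: (FactorsD (a := a) (b := b) (g := fun=> 0)); first exact: Factors0.
by move=> x; rewrite addr0.
Qed.

Lemma factorsD I (V : I -> lmodType A) X Y (f g : X -> Y) :
  factors V f -> factors V g -> factors V (fun x => f x + g x).
Proof.
move=> Vf; elim: Vf g => [f' f0|f' h i a b _ IH fE] g Vg.
  by apply: eq_factors Vg => x; rewrite f0 add0r.
apply: (FactorsD (a := a) (b := b) (IH _ Vg)) => x.
by rewrite fE addrA.
Qed.

Lemma factors_sum I (V : I -> lmodType A) X Y (J : finType) (f : J -> X -> Y) :
  (forall j, factors V (f j)) -> factors V (fun x => \sum_j f j x).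
Proof.
move=> Vf; elim: (index_enum J) => [|j s IHs].
  by apply: Factors0 => x; rewrite big_nil.
by apply: eq_factors (factorsD (Vf j) IHs) => x; rewrite big_cons.
Qed.

Lemma factors_comp I (V : I -> lmodType A) X' X Y Y' (f : X -> Y)
    (h : {linear X' -> X}) (k : {linear Y -> Y'}) :
  factors V f -> factors V (fun x => k (f (h x))).
Proof.
elim=> {f} [f f0|f g i a b _ IH fE].
  by apply: Factors0 => x; rewrite f0 linear0.
apply: (FactorsD (a := a \o h) (b := k \o b) IH) => x.
by rewrite fE linearD.
Qed.

Lemma factors_trans I (V : I -> lmodType A) J (W : J -> lmodType A) X Y (f : X -> Y) :
  (forall i, factors W (@id (V i))) -> factors V f -> factors W f.
Proof.
move=> VW; elim=> {f} [f f0|f g i a b _ IH fE]; first exact: Factors0.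
apply: eq_factors (factorsD (factors_comp a b (VW i)) IH) => x.
by rewrite fE.
Qed.

Lemma isomorphic_inv U V :
  isomorphic U V -> exists (f : {linear U -> V}) (g : {linear V -> U}),
    cancel f g /\ cancel g f.
Proof.
move=> [f [g0 fK gK]]; have [g gE] := linear_ex (can2_linear fK gK).
by exists f, g; split=> x; rewrite gE.
Qed.

Lemma prod_maps_ex X Y :
  exists (i1 : {linear X -> (X * Y)%type}) (i2 : {linear Y -> (X * Y)%type})
         (p1 : {linear (X * Y)%type -> X}) (p2 : {linear (X * Y)%type -> Y}),
    [/\ forall x, i1 x = (x, 0), forall y, i2 y = (0, y),
        forall z, p1 z = z.1 & forall z, p2 z = z.2].
Proof.
have [|i1 i1E] := @linear_ex A X (X * Y)%type (fun x => (x, 0)).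
  by move=> a u v; apply/pair_equal_spec; rewrite /= scaler0 addr0.
have [|i2 i2E] := @linear_ex A Y (X * Y)%type (fun y => (0, y)).
  by move=> a u v; apply/pair_equal_spec; rewrite /= scaler0 addr0.
have [|p1 p1E] := @linear_ex A (X * Y)%type X (fun z => z.1) => //.
have [|p2 p2E] := @linear_ex A (X * Y)%type Y (fun z => z.2) => //.
by exists i1, i2, p1, p2.
Qed.

Lemma dsum_maps_ex (I : finType) (V : I -> lmodType A) :
  exists (inj : forall i, {linear V i -> dsum V})
         (prj : forall i, {linear dsum V -> V i}),
    (forall i x, prj i (inj i x) = x) /\ forall x, x = \sum_i inj i (prj i x).
Proof.
have exP i : exists p : {linear dsum V -> V i}, forall x, p x = x i.
  by apply: linear_ex => a u v; rewrite !ffunE.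
pose inj0 i (x : V i) : dsum V := [ffun j => dfwith (fun j => 0 : V j) x j].
have injE i j x : j != i -> inj0 i x j = 0.
  by move=> ji; rewrite ffunE dfwith_out // eq_sym.
have injT i x : inj0 i x i = x by rewrite ffunE dfwith_in.
have exI i : exists p : {linear V i -> dsum V}, forall x, p x = inj0 i x.
  apply: linear_ex => a u v; apply/ffunP => j; rewrite [RHS]ffunE [X in _ = X + _]ffunE.
  have [<-|ji] := eqVneq i j; first by rewrite !injT.
  by rewrite !injE 1?eq_sym // scaler0 addr0.
pose prj i := sval (cid (exP i)); pose inj i := sval (cid (exI i)).
have prjE i x : prj i x = x i by exact: (svalP (cid (exP i))).
have inj1E i x : inj i x = inj0 i x by exact: (svalP (cid (exI i))).
exists inj, prj; split=> [i x|x]; first by rewrite prjE inj1E injT.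
apply/ffunP => j; rewrite -[RHS]prjE linear_sum (bigD1 j) //= big1 => [|i ij].
  by rewrite prjE inj1E injT prjE addr0.
by rewrite prjE inj1E injE // eq_sym.
Qed.

Lemma dsum_factors (I : finType) (V : I -> lmodType A) : factors V (@id (dsum V)).
Proof.
have [inj [prj [_ E]]] := dsum_maps_ex V.
apply: (@eq_factors _ _ _ _ (fun x => \sum_i inj i (prj i x))) => [x|].
  by rewrite -E.
by apply: factors_sum => i; apply: factors_single.
Qed.

Lemma factors_dsum (I : finType) (V : I -> lmodType A) i :
  factors (fun _ : unit => dsum V : lmodType A) (@id (V i)).
Proof.
have [inj [prj [K _]]] := dsum_maps_ex V.
have Vi := @factors_single _ (fun _ : unit => dsum V : lmodType A) _ _ tt
  (inj i) (prj i).
by apply: eq_factors Vi => x; apply: K.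
Qed.

Lemma ffun_factors k (G : lmodType A) :
  factors (fun _ : unit => G) (@id {ffun 'I_k -> G}).
Proof.
have exP i : exists p : {linear {ffun 'I_k -> G} -> G}, forall x, p x = x i.
  by apply: linear_ex => a u v; rewrite !ffunE.
have exI i : exists p : {linear G -> {ffun 'I_k -> G}},
    forall x, p x = [ffun j => if j == i then x else 0].
  apply: linear_ex => a u v; apply/ffunP => j; rewrite !ffunE.
  by case: eqP; rewrite // scaler0 addr0.
have [prj prjE] := choice exP; have [inj injE] := choice exI.
apply: (@eq_factors _ _ _ _ (fun x => \sum_i inj i (prj i x))) => [x|].
  apply/ffunP => j; rewrite sum_ffunE (bigD1 j) //= big1 => [|i ij].
    by rewrite injE prjE ffunE eqxx addr0.
  by rewrite injE ffunE eq_sym (negPf ij).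
by apply: factors_sum => i; apply: (factors_single (i := tt)).
Qed.

Lemma add_closure_factors (G X : lmodType A) :
  add_closure G X -> factors (fun _ : unit => G) (@id X).
Proof.
move=> [k [Y /isomorphic_inv[f [g [fK _]]]]].
have [i1 [_ [p1 [_ [i1E _ p1E _]]]]] := prod_maps_ex X Y.
apply: eq_factors (factors_comp (f \o i1) (p1 \o g) (ffun_factors k G)) => x.
by rewrite /= fK p1E i1E.
Qed.

Lemma factors_families (G X Y : lmodType A) (f : X -> Y) :
  factors (fun _ : unit => G) f ->
  exists k (a : 'I_k -> {linear X -> G}) (b : 'I_k -> {linear G -> Y}),
    forall x, f x = \sum_t b t (a t x).
Proof.
elim=> {f} [f f0|f g _ a b _ [k [a' [b' E]]] fE].
  have noI (i : 'I_0) : False by case: i.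
  exists 0%N, (fun i => False_rect _ (noI i)), (fun i => False_rect _ (noI i)).
  by move=> x; rewrite f0 big_ord0.
exists k.+1, (fun i => if unlift ord0 i is Some j then a' j else a).
exists (fun i => if unlift ord0 i is Some j then b' j else b) => x.
rewrite fE E big_ord_recl unlift_none; congr (_ + _).
by apply: eq_bigr => i _; rewrite liftK.
Qed.

(** The families make [X] a retract of a power of [G]; the complement of a retract is a summand. *)
Lemma factors_add_closure (G X : lmodType A) :
  factors (fun _ : unit => G) (@id X) -> add_closure G X.
Proof.
move=> /factors_families[k [a [b E]]].
have [|i iE] := @linear_ex A X {ffun 'I_k -> G} (fun x => [ffun t => a t x]).
  by move=> c u v; apply/ffunP => t; rewrite !ffunE linearP.
have [|p pE] := @linear_ex A {ffun 'I_k -> G} X (fun z => \sum_t b t (z t)).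
  move=> c u v; rewrite scaler_sumr -big_split; apply: eq_bigr => t _.
  by rewrite !ffunE linearP.
have iK x : p (i x) = x.
  by rewrite pE [RHS]E; apply: eq_bigr => t _; rewrite iE ffunE.
(* [N] is the image of the idempotent [i \o p]. The complement is taken as the quotient by [N], with
   [r], induced by [1 - i p], as section. *)
have [|c u v uE vE|N NE] := @submod_ex A {ffun 'I_k -> G} (fun z => i (p z) = z).
- by rewrite !linear0.
- by rewrite !linearP uE vE.
pose r (y : quotmod N) := quot_repr y - i (p (quot_repr y)).
have rE z : r (quot_proj N z) = z - i (p z).
  have /quot_projP/NE := quot_reprK (quot_proj N z).
  rewrite /r; set w := quot_repr _; rewrite !linearB /= => E1.
  by rewrite -{1}(subrK z w) -E1 addrAC [_ - _ - _]addrAC subrr add0r addrC.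
clearbody r.
have rl : linear r.
  move=> c u v; rewrite -[u]quot_reprK -[v]quot_reprK -linearP !rE.
  by rewrite [p _]linearP [i _]linearP scalerBr opprD addrACA.
exists k, (quotmod N).
have [|f fE] := @linear_ex A (X * quotmod N)%type {ffun 'I_k -> G}
    (fun z => i z.1 + r z.2).
  by move=> c u v; rewrite /= rl [i _]linearP scalerDr addrACA.
exists f; exists (fun z => (p z, quot_proj N z)) => [[x y]|z]; last first.
  by rewrite fE /= rE addrC subrK.
rewrite fE -[y]quot_reprK /= rE; congr (_, _).
  by rewrite linearD linearB !iK subrr addr0.
apply/quot_projP/NE; set w := quot_repr y.
have -> : i x + (w - i (p w)) - w = i (x - p w) by rewrite linearB addrA addrAC addrK.
by rewrite iK.
Qed.

End Factorizations.

(** * Projective modules and lifting *)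

Section Projectives.
Variable A : pzRingType.
Implicit Types P U V W X Y : lmodType A.

(** Coordinates of a section of a free cover. They define maps from [P] to modules that need not be
    finitely generated, beyond the reach of the lifting property itself. *)
Lemma projective_dual_basis P :
  projective P ->
  exists k (p : 'I_k -> P) (phi : 'I_k -> {linear P -> A^o}),
    forall x, x = \sum_t (phi t x : A) *: p t.
Proof.
move=> [fgP liftP]; have [k [p gen]] := fgP.
pose F : lmodType A := {ffun 'I_k -> A^o}.
have [|g gE] := @linear_ex A F P (fun c : F => \sum_t (c t : A) *: p t).
  move=> a u v; rewrite scaler_sumr -big_split; apply: eq_bigr => t _.
  by rewrite !ffunE scalerDl scalerA.
have fgF : finitely_generated F.
  exists k, (fun t => [ffun s => (s == t)%:R : A^o]) => c; exists (fun t => c t).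
  apply/ffunP => s; rewrite sum_ffunE (bigD1 s) //= big1 => [|t ts].
    by rewrite !ffunE eqxx addr0 -[RHS]/(c s * 1) mulr1.
  by rewrite !ffunE eq_sym (negPf ts) scaler0.
have sg : surjective_map g.
  move=> x; have [c ->] := gen x; exists (finfun c); rewrite gE.
  by apply: eq_bigr => t _; rewrite ffunE.
have [|s sE] := @linear_ex A P P idfun; first by [].
have [r rE] := liftP F P g s fgF fgP sg.
have exP t : exists phi : {linear P -> A^o}, forall x, phi x = (r x : F) t.
  by apply: linear_ex => a u v; rewrite linearP !ffunE.
have [phi phiE] := choice exP.
exists k, p, phi => x; rewrite -[LHS]sE -rE gE.
by apply: eq_bigr => t _; rewrite phiE.
Qed.

Lemma projective_retract P X (i : {linear X -> P}) (p : {linear P -> X}) :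
  (forall x, p (i x) = x) -> projective P -> projective X.
Proof.
move=> pK [[k [s gen]] liftP]; split.
  exists k, (fun t => p (s t)) => x; have [c E] := gen (i x); exists c.
  by rewrite -[LHS]pK E linear_sum; apply: eq_bigr => t _; rewrite linearZ.
move=> Y Z g h fgY fgZ sg.
have [r rE] := liftP Y Z g (h \o p) fgY fgZ sg.
by exists (r \o i) => x; rewrite /= rE /= pK.
Qed.

Lemma projective_regular : projective (A^o : lmodType A).
Proof.
split.
  exists 1%N, (fun=> 1) => v; exists (fun=> v).
  by rewrite big_ord1 -[RHS]/(v * 1) mulr1.
move=> X Y g h _ _ sg; have [x xE] := sg (h 1).
exists (act_on x) => a.
rewrite /= /act_on linearZ xE -linearZ; congr (h _); exact: mulr1.
Qed.

Lemma quot_desc U W (N : submodClosed U) (f : {linear U -> W}) :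
  (forall u, u \in N -> f u = 0) ->
  exists g : {linear quotmod N -> W}, forall u, g (quot_proj N u) = f u.
Proof.
move=> fN.
have fE u : f (quot_repr (quot_proj N u)) = f u.
  by apply/eqP; rewrite -subr_eq0 -linearB fN //; apply/quot_projP/quot_reprK.
have [|g gE] := @linear_ex A (quotmod N) W (fun x => f (quot_repr x)).
  move=> a u v; rewrite -[u]quot_reprK -[v]quot_reprK -linearP !fE.
  exact: linearP.
by exists g => u; rewrite gE fE.
Qed.

Lemma quot_map_ex U V (N : submodClosed U) (K : submodClosed V) (f : {linear U -> V}) :
  (forall u, u \in N -> f u \in K) ->
  exists g : {linear quotmod N -> quotmod K},
    forall u, g (quot_proj N u) = quot_proj K (f u).
Proof.
move=> fNK; apply: (quot_desc (f := @quot_proj A V K \o f)) => u /fNK Kfu /=.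
by rewrite -(linear0 (@quot_proj A V K)); apply/quot_projP; rewrite subr0.
Qed.

(** [X |-> X / Rad^j X] is an additive functor, so it carries each composite in the sum to one
    through the quotients. *)
Lemma factors_rad_quot I (V : I -> lmodType A) X Y j (f : X -> Y)
    (g : quotmod (rad_series X j) -> quotmod (rad_series Y j)) :
  factors V f -> (forall x, g (quot_proj _ x) = quot_proj _ (f x)) ->
  factors (fun i => quotmod (rad_series (V i) j) : lmodType A) g.
Proof.
pose W i : lmodType A := quotmod (rad_series (V i) j).
move=> Vf; elim: Vf g => {f} [f f0|f f' i a b _ IH fE] g gE.
  by apply: Factors0 => x; rewrite -[x]quot_reprK gE f0 linear0.
have [a' aE] := quot_map_ex (fun x => @rad_series_functor A _ _ a j x).
have [b' bE] := quot_map_ex (fun x => @rad_series_functor A _ _ b j x).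
have Vg' : factors W (fun x => g x - b' (a' x)).
  by apply: IH => x; rewrite gE aE bE fE linearD addrC addKr.
by apply: (@FactorsD A _ W _ _ g _ i a' b' Vg') => x; rewrite addrC subrK.
Qed.

(** Submodules with the same elements may be different terms, making the quotients different types;
    this transports between them. *)
Lemma factors_subquot U (N K : submodClosed U) :
  {subset N <= K} -> {subset K <= N} ->
  factors (fun _ : unit => quotmod K : lmodType A) (@id (quotmod N)).
Proof.
move=> sNK sKN; have [f fE] := @linear_ex A U U idfun (fun _ _ _ => erefl).
have [|g gE] := @quot_map_ex U U N K f; first by move=> u; rewrite fE => /sNK.
have [|h hE] := @quot_map_ex U U K N f; first by move=> u; rewrite fE => /sKN.
have F := @factors_single A _ (fun _ : unit => quotmod K : lmodType A) _ _ tt g h.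
by apply: eq_factors F => x; rewrite -[x]quot_reprK gE hE !fE.
Qed.

(* Otherwise choose a minimal left ideal isomorphic to a projective module not
   built from the P i: it is neither zero nor indecomposable, so one of its two
   summands gives a smaller such left ideal. *)
Lemma regular_factors n (P : 'I_n -> lmodType A) :
  artin_algebra A -> complete_projective_indecomposables P ->
  factors P (@id A^o).
Proof.
move=> hA [_ _ hP]; apply: contrapT => badA.
pose bad (X : lmodType A) := projective X /\ ~ factors P (@id X).
pose C (N : submodClosed A^o) := exists (X : lmodType A) (i : {linear X -> A^o}),
  [/\ bad X, injective i & forall v, v \in N <-> exists x, i x = v].
have [|N [X [i [[prX badX] injI NE]]] minN] := artin_minimal (C := C) hA.
  have [f fE] := @linear_ex A A^o A^o idfun (fun _ _ _ => erefl).
  exists full_submod, A^o, f; split=> [|x y|v].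
  - by split; [exact: projective_regular|].
  - by rewrite !fE.
  - by split=> // _; exists v; rewrite fE.
(* A bad retract [Y] would have its image in [C], hence equal to [N] by minimality; then [x] comes
   from [Y], and [p x = 0] forces [x = 0]. *)
have good Y (j : {linear Y -> X}) (p : {linear X -> Y}) x :
    (forall y, p (j y) = y) -> x != 0 -> p x = 0 -> factors P (@id Y).
  move=> pK x0 px0; apply: contrapT => badY.
  have [|a u v [y <-] [z <-]|K KE] := @submod_ex A A^o (fun v => exists y, i (j y) = v).
  - by exists 0; rewrite !linear0.
  - by exists (a *: y + z); rewrite !linearP.
  have CK : C K.
    exists Y, (i \o j); split=> //; last by move=> y z /injI/(can_inj pK).
    by split=> //; apply: projective_retract pK prX.
  have /KE[y /injI xE] : i x \in K.
    apply: minN => //; last by apply/NE; exists x.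
    by move=> _ /KE[y <-]; apply/NE; exists (j y).
  by case/eqP: x0; rewrite -xE; move: px0; rewrite -xE pK => ->; rewrite linear0.
apply: badX; have [zX|nzX] := pselect (zero_module X); first exact: Factors0.
have [indX|] := pselect (indecomposable X).
  have [k /isomorphic_inv[f [g [fK _]]]] := hP X prX indX.
  by apply: eq_factors (factors_single f g) => x; rewrite fK.
move=> /not_andP[//|/existsNP[Y /existsNP[Z /not_implyP[isoX /not_orP[nzY nzZ]]]]].
have [f [g [fK gK]]] := isomorphic_inv isoX.
have [i1 [i2 [p1 [p2 [i1E i2E p1E p2E]]]]] := prod_maps_ex Y Z.
have nz W : ~ zero_module W -> exists w : W, w != 0.
  by move=> /existsNP[w /eqP w0]; exists w.
have nzf z : z != 0 -> f z != 0.
  by apply: contra_neq => fz0; rewrite -(fK z) fz0 linear0.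
have [[y y0] [z z0]] := (nz _ nzY, nz _ nzZ).
have PY : factors P (@id Y).
  apply: (good Y (f \o i1) (p1 \o g) (f (i2 z))) => [w||] /=.
  - by rewrite fK p1E i1E.
  - by apply: nzf; rewrite i2E; apply: contra_neq z0 => -[].
  - by rewrite fK p1E i2E.
have PZ : factors P (@id Z).
  apply: (good Z (f \o i2) (p2 \o g) (f (i1 y))) => [w||] /=.
  - by rewrite fK p2E i2E.
  - by apply: nzf; rewrite i1E; apply: contra_neq y0 => -[].
  - by rewrite fK p2E i1E.
apply: eq_factors (factorsD (factors_comp (p1 \o g) (f \o i1) PY)
                            (factors_comp (p2 \o g) (f \o i2) PZ)) => x /=.
rewrite -linearD i1E i2E p1E p2E -[RHS]gK; congr (f _).
by case: (g x) => a b; apply/pair_equal_spec; rewrite /= addr0 add0r.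
Qed.

End Projectives.

(** * The module [G] and its summands *)

Section RadQuotientsSum.
Variables (A : pzRingType) (n : nat) (P : 'I_n -> lmodType A) (l : 'I_n -> nat).

Lemma rad_quotients_sum_factors :
  factors (fun s : {i : 'I_n & 'I_(l i)} =>
      quotmod (rad_series (P (tag s)) (tagged s).+1) : lmodType A)
    (@id (rad_quotients_sum P l)).
Proof.
apply: (factors_trans _ (dsum_factors _)) => i.
apply: (factors_trans _ (dsum_factors _)) => j.
have [f fE] := @linear_ex A _ (quotmod (rad_series (P i) j.+1)) idfun (fun _ _ _ => erefl).
have F := @factors_single A _ (fun s : {i : 'I_n & 'I_(l i)} =>
  quotmod (rad_series (P (tag s)) (tagged s).+1) : lmodType A)
  _ _ (Tagged (fun i => 'I_(l i)) j) f f.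
by apply: eq_factors F => x; rewrite !fE.
Qed.

Hypothesis hl : forall i, loewy_length (P i) (l i).
Hypothesis nzP : forall i, ~ zero_module (P i).

Lemma factors_rad_quotients_sum i m :
  factors (fun _ : unit => rad_quotients_sum P l)
    (@id (quotmod (rad_series (P i) m))).
Proof.
case: m => [|m].
  apply: Factors0 => x; rewrite -[x]quot_reprK -(linear0 (quot_proj _)).
  exact/quot_projP.
have [l0 _] := hl i.
have li : (0 < l i)%N.
  rewrite lt0n; apply/eqP => li0; apply: (nzP (i := i)) => v.
  by apply/eqP; rewrite li0 in l0; rewrite -[v == 0]/(v \in zero_submod) -l0.
(* The exponent is capped at [l i], beyond which the radicals vanish; the predecessor accounts for
   indices starting at 0. *)
have ltj : ((minn m.+1 (l i)).-1 < l i)%N by rewrite prednK ?geq_minr // leq_min li.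
pose j := Ordinal ltj.
have jE : j.+1 = minn m.+1 (l i) by rewrite prednK // leq_min li.
have sub1 : {subset rad_series (P i) m.+1 <= rad_series (P i) j.+1}.
  by apply: rad_series_subset; rewrite jE geq_minl.
have sub2 : {subset rad_series (P i) j.+1 <= rad_series (P i) m.+1}.
  move=> v; rewrite jE; case: leqP => // _; rewrite l0 => /eqP->.
  exact: rpred0.
apply: (factors_trans _ (factors_subquot sub1 sub2)) => _.
pose D i (k : 'I_(l i)) : lmodType A := quotmod (rad_series (P i) k.+1).
apply: (factors_trans _ (factors_dsum (@D i) j)) => _.
exact: (factors_dsum (fun i => dsum (@D i) : lmodType A) i).
Qed.

End RadQuotientsSum.

(** * Modules over the quotient algebra, seen over [A] *)

Section Restrictions.
Variables (A : pzRingType) (m : nat).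
Local Notation B := (rad_quot A m).
Local Notation restr := (restrict (@rad_proj A m)).

Lemma rad_quot_scaleE (a : A) (x : B) :
  quot_scale (N := rad_series A^o m) a x = rad_proj m a * x.
Proof. rewrite -[x in RHS]rad_reprK -[RHS]/(rad_mul (rad_proj m a) (rad_proj m _)).
by rewrite rad_mulE. Qed.

Lemma restrict_factors_regular (Q : lmodType B) :
  projective Q ->
  factors (fun _ : unit => quotmod (rad_series A^o m) : lmodType A) (@id (restr Q)).
Proof.
move=> /projective_dual_basis[k [q [phi E]]].
have exA t : exists a : {linear restr Q -> quotmod (rad_series A^o m)},
    forall x, a x = phi t x.
  apply: linear_ex => c u v; rewrite [LHS](linearP (phi t) (rad_proj m c)).
  by congr (_ + _); rewrite -[RHS]/(quot_scale c _) rad_quot_scaleE.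
have exB t : exists b : {linear quotmod (rad_series A^o m) -> restr Q},
    forall x, b x = (x : B) *: q t.
  apply: linear_ex => c u v; rewrite -[c *: u]/(quot_scale c u).
  by rewrite [quot_scale _ _]rad_quot_scaleE scalerDl -scalerA.
have [a aE] := choice exA; have [b bE] := choice exB.
apply: (@eq_factors _ _ _ (restr Q) (restr Q) (fun x => \sum_t b t (a t x))) => [x|].
  by rewrite [RHS]E; apply: eq_bigr => t _; rewrite bE aE.
by apply: factors_sum => t; apply: (factors_single (i := tt)).
Qed.

Lemma restrict_rad_series (Q : lmodType B) x :
  artin_algebra A -> x \in rad_series (restr Q) m -> x = 0.
Proof.
move=> hA rx; apply/eqP; rewrite -[_ == _]/(x \in zero_submod).
apply: rad_series_minimal rx => // a w ra.
rewrite -[a *: w]/(rad_proj m a *: (w : Q)).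
have -> : rad_proj m a = 0.
  by rewrite -(rmorph0 (@rad_proj A m)); apply/rad_projP; rewrite subr0.
by rewrite scale0r rpred0.
Qed.

Lemma projective_cover_right_minimal (M : lmodType A) (hm : loewy_length M m)
    (Q : lmodType B) (f : {linear Q -> descend hm}) :
  projective_cover f -> right_minimal (regard f : {linear restr Q -> M}).
Proof.
move=> [[fgQ liftQ] _ superf] g gE.
have {}gE x : f (g x) = f x by exact: gE.
(* [y - h y] lies in the kernel of [f], so the image of [h] and this kernel span [Q]. *)
have onto (h : {linear Q -> Q}) : (forall x, f (h x) = f x) -> surjective_map h.
  move=> hE; have [N NE] := image_submod_ex h full_submod => x.
  suff /NE[y _ <-] : x \in N by exists y.
  apply: superf => y; exists (h y); first by apply/NE; exists y.
  by rewrite linearB hE subrr.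
(* Every scalar of [B] is the class of one of [A], so [g] is linear over [B] too. *)
have [|h hE] := @linear_ex B Q Q g.
  move=> b u v; rewrite -[b]rad_reprK.
  exact: (linearP g (rad_repr b)).
have [e eE] := @linear_ex B Q Q idfun (fun _ _ _ => erefl).
have sh : surjective_map h by apply: onto => x; rewrite hE.
have [s sE] := liftQ Q Q h e fgQ fgQ sh.
have {}sE x : g (s x) = x by rewrite -hE sE eE.
have ss : surjective_map s by apply: onto => x; rewrite -gE sE.
by exists s => // x; have [y <-] := ss x; rewrite sE.
Qed.

End Restrictions.

(** * Lifting through the cover by rigidity *)

Section Lifting.
Variables (A : pzRingType) (hA : artin_algebra A).

Lemma loewy_length_uniq (V : lmodType A) m m' :
  loewy_length V m -> loewy_length V m' -> m = m'.
Proof. by move=> [z min] [z' min']; apply/eqP; rewrite eqn_leq min ?min'. Qed.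

Lemma rigid_quot_lift (P U M : lmodType A) (f : {linear U -> M}) m j
    (h : {linear quotmod (rad_series P j) -> M}) :
  projective P -> surjective_map f -> rigid M -> loewy_length M m ->
  (forall x, x \in rad_series U m -> x = 0) ->
  exists g : {linear quotmod (rad_series P j) -> U}, forall x, f (g x) = h x.
Proof.
move=> prP sf [m' hm' rigM] hm U0.
rewrite {m' hm'}(loewy_length_uniq hm' hm) in rigM.
have [k [p [phi E]]] := projective_dual_basis prP.
pose h' : {linear P -> M} := h \o @quot_proj A P (rad_series P j).
have h0 x : x \in rad_series P (0 + j) -> h' x = 0.
  move=> rx; rewrite -(linear0 h); congr (h _).
  by rewrite -(linear0 (quot_proj _)); apply/quot_projP; rewrite subr0.
have hr x : h' x \in rad_series M (m - j).
  (* For [j > m] the truncated difference is 0, and the zeroth radical is all of [M]. *)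
  have [jm|/ltnW] := leqP j m; last by rewrite -subn_eq0 => /eqP->.
  rewrite rigM //; apply: soc_series_killed => //.
  exact: (rad_killed_image h0).
have exU t : exists u, u \in rad_series U (m - j) /\ f u = h' (p t).
  by have [u ru uE] := rad_series_lift hA sf (hr (p t)); exists u.
have [u uP] := choice exU.
have [|g gE] := @linear_ex A P U (fun x => \sum_t (phi t x : A) *: u t).
  move=> a x y; rewrite scaler_sumr -big_split; apply: eq_bigr => t _.
  by rewrite linearP /= scalerDl scalerA.
(* On the [j]-th radical of [P] the coordinates lie in the [j]-th radical of [A], so the values land
   in the radical of [U] of index [j + (m - j)], at least [m], which is zero. *)
have [|g' g'E] := @quot_desc A P U (rad_series P j) g.
  move=> x rx; rewrite gE big1 // => t _; apply: U0.
  apply: (@rad_series_subset _ _ _ (j + (m - j))); first by rewrite -leq_subLR.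
  by apply: rad_series_act (uP t).1; apply: rad_series_functor.
exists g' => x; rewrite -[x]quot_reprK; set y := quot_repr x.
rewrite g'E gE -[RHS]/(h' y) [in RHS](E y) !linear_sum.
by apply: eq_bigr => t _; rewrite !linearZ (uP t).2.
Qed.

Lemma factors_lift I (V : I -> lmodType A) (U M X Y : lmodType A)
    (f : {linear U -> M}) (h : {linear Y -> M}) (e : X -> Y) :
  (forall i (h' : {linear V i -> M}),
     exists g : {linear V i -> U}, forall x, f (g x) = h' x) ->
  factors V e -> exists g : {linear X -> U}, forall x, f (g x) = h (e x).
Proof.
move=> liftV; elim=> {e} [e e0|e e' i a b _ [g gE] eE].
  have [|g gE] := @linear_ex A X U (fun=> 0); last first.
    by exists g => x; rewrite gE e0 !linear0.
  by move=> c x y; rewrite scaler0 addr0.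
have [g1 g1E] := liftV i (h \o b).
have [|g2 g2E] := @linear_ex A X U (fun x => g1 (a x) + g x).
  by move=> c x y; rewrite !linearP scalerDr addrACA.
by exists g2 => x; rewrite g2E eE !linearD g1E gE.
Qed.

End Lifting.

Theorem theorem5p1 (A : pzRingType) (hA : artin_algebra A)
    (n : nat) (P : 'I_n -> lmodType A)
    (hP : complete_projective_indecomposables P)
    (l : 'I_n -> nat) (hl : forall i, loewy_length (P i) (l i))
    (M : lmodType A) (hfg : finitely_generated M) (hrigid : rigid M)
    (m : nat) (hm : loewy_length M m)
    (Q : lmodType (rad_quot A m)) (f : {linear Q -> descend hm})
    (hf : projective_cover f) :
  right_minimal_approximation (add_closure (rad_quotients_sum P l))
    (regard f : {linear restrict (@rad_proj A m) Q -> M}).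
Proof.
have [prQ sf _] := hf; have [prP _ _] := hP.
have nzP i : ~ zero_module (P i) by have [_ []] := prP i.
split; last exact: projective_cover_right_minimal.
split.
  (* Summands are traced from [Q] to copies of [A / Rad^m A], then to the [P i / Rad^m (P i)], then
     to [G]. *)
  apply: factors_add_closure.
  apply: (factors_trans _ (restrict_factors_regular prQ)) => _.
  apply: (factors_trans _ (factors_rad_quot (regular_factors hA hP) _)) => // i.
  exact: factors_rad_quotients_sum.
move=> X h /add_closure_factors GX.
(* Lifting from a member of [add G] reduces to lifting from the single quotients
   [P i / Rad^(j+1) (P i)]. *)
have VX := factors_trans (fun _ => rad_quotients_sum_factors P l) GX.
apply: (factors_lift h _ VX) => -[i j] h' /=.
pose g : {linear restrict (@rad_proj A m) Q -> M} := regard f.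
apply: (@rigid_quot_lift A hA (P i) _ M g m _ h' (prP i).1) => // x.
exact: restrict_rad_series.
Qed.
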